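(* Let $G$ be a finite group, let $\mathsf{S}$ be a supercharacter theory of $G$, and let $N$ be an $\mathsf{S}$-normal subgroup of $G$. Then $[N,\mathsf{S}]=\langle g^{-1}k:g\in N,\ k\in\mathrm{cl}_{\mathsf{S}}(g)\rangle$ is $\mathsf{S}$-normal.
   Context: Let $G$ be a finite group and $\mathrm{Irr}(G)$ its set of complex irreducible characters. A supercharacter theory $\mathsf{S}$ of $G$ is a pair $(\mathcal{X}_{\mathsf{S}},\mathcal{K}_{\mathsf{S}})$, where $\mathcal{X}_{\mathsf{S}}$ is a partition of $\mathrm{Irr}(G)$ and $\mathcal{K}_{\mathsf{S}}$ is a partition of $G$, such that $\{1\}\in\mathcal{K}_{\mathsf{S}}$, $|\mathcal{X}_{\mathsf{S}}|=|\mathcal{K}_{\mathsf{S}}|$, and for each $X\in\mathcal{X}_{\mathsf{S}}$ there is a (nonzero) character $\xi_X$ whose constituents lie in $X$ and which is constant on the parts of $\mathcal{K}_{\mathsf{S}}$. It is known that every part of $\mathcal{K}_{\mathsf{S}}$ is then a union of conjugacy classes. The parts of $\mathcal{K}_{\mathsf{S}}$ are called $\mathsf{S}$-classes, and $\mathrm{cl}_{\mathsf{S}}(g)$ is the $\mathsf{S}$-class containing $g$. A subgroup of $G$ is $\mathsf{S}$-normal if it is a union of $\mathsf{S}$-classes. *)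

(* Defs.v *)
From mathcomp Require Import all_boot all_order all_algebra all_fingroup.
From mathcomp Require Import all_solvable all_field all_character.

Set Implicit Arguments.
Unset Strict Implicit.
Unset Printing Implicit Defensive.

Import GroupScope.

(* Irreducible characters are handled through their indices: a part of Irr(G) *)
(* is a set of indices i : Iirr G. Ordinary complex characters are the        *)
(* algC-valued characters of MathComp.                                        *)
Record supercharacter_theory (gT : finGroupType) (G : {group gT}) :=
  SupercharacterTheory {
    sct_irr : {set {set Iirr G}};
    sct_class : {set {set gT}};
    sct_irr_partition : partition sct_irr [set: Iirr G];
    sct_class_partition : partition sct_class G;
    sct_class1 : [set 1] \in sct_class;
    sct_card : #|sct_irr| = #|sct_class|;
    sct_char : forall X : {set Iirr G}, X \in sct_irr ->
      exists xi : 'CF(G),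
        [/\ xi \is a character, xi != 0%R,
            {subset irr_constt xi <= X} &
            forall K : {set gT}, K \in sct_class ->
              {in K &, forall g h : gT, xi g = xi h}]
  }.

(* The block containing g; it is set0 when g \notin G. *)
Definition sct_cl (gT : finGroupType) (G : {group gT})
    (S : supercharacter_theory G) (g : gT) : {set gT} :=
  pblock (sct_class S) g.

(* H is then automatically contained in G. *)
Definition sct_normal (gT : finGroupType) (G : {group gT})
    (S : supercharacter_theory G) (H : {group gT}) : Prop :=
  exists2 P : {set {set gT}}, P \subset sct_class S & H :=: cover P.

Definition sct_commg (gT : finGroupType) (G : {group gT})
    (S : supercharacter_theory G) (N : {group gT}) : {group gT} :=
  [group of <<[set g^-1 * k | g in N, k in sct_cl S g]>>].

(* Main.v *)
Require Import Defs.
From mathcomp Require Import all_boot all_order all_algebra all_fingroup.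
From mathcomp Require Import all_solvable all_field all_character.

Import GroupScope.

(** A subgroup of [G] is S-normal exactly when it contains the S-class of each
    of its elements ([sct_normalP]), so [[N, S]] only has to be shown closed under
    passing to S-classes.  As [N] is S-normal, the generators [g^-1 * k] lie in
    [N], hence so does [[N, S]].  Thus if [h] is in [[N, S]] and [k] is in the
    S-class of [h], then [h^-1 * k] is itself one of the generators, and
    [k = h * (h^-1 * k)] is in [[N, S]]. *)

Lemma sct_normalP (gT : finGroupType) (G : {group gT})
    (S : supercharacter_theory G) (H : {group gT}) :
  sct_normal S H <->
  H \subset G /\ {in H, forall h, sct_cl S h \subset H}.
Proof.
have [/eqP covS trivS _] := and3P (sct_class_partition S).
split=> [[P sPS defH] | [sHG clH]].
  have clH: {in H, forall h, sct_cl S h \subset H}.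
    move=> h; rewrite defH => /bigcupP[K PK Kh].
    rewrite /sct_cl (def_pblock trivS (subsetP sPS K PK) Kh).
    exact: bigcup_sup.
  split=> //; rewrite defH -covS; apply/bigcupsP=> K PK.
  exact: bigcup_sup (subsetP sPS K PK).
exists [set K in sct_class S | K \subset H].
  by apply/subsetP=> K; rewrite inE => /andP[].
apply/eqP; rewrite eqEsubset; apply/andP; split.
  apply/subsetP=> h Hh.
  have covh: h \in cover (sct_class S) by rewrite covS (subsetP sHG).
  apply/bigcupP; exists (sct_cl S h); last by rewrite mem_pblock.
  by rewrite inE pblock_mem //= clH.
by apply/bigcupsP=> K; rewrite inE => /andP[].
Qed.

Theorem corollary10 (gT : finGroupType) (G : {group gT})
    (S : supercharacter_theory G) (N : {group gT}) :
  sct_normal S N -> sct_normal S (sct_commg S N).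
Proof.
move=> /sct_normalP[sNG clN].
have sHN: sct_commg S N \subset N.
  rewrite gen_subG; apply/subsetP=> _ /imset2P[g k Ng gk ->].
  by rewrite groupM ?groupV // (subsetP (clN g Ng)).
apply/sct_normalP; split=> [|h Hh]; first exact: subset_trans sHN sNG.
apply/subsetP=> k hk; rewrite -(mulKVg h k) groupM //.
by apply: mem_gen; apply: imset2_f => //; apply: subsetP Hh.
Qed.
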